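(* For every $\mathrm{k}\in\mathbb{N}$, the following problem (EL-k Step Persistence Problem) is decidable: given a place/transition net $\mathrm{S}=(P,T,F,M_0)$, a marking $M\in\mathbb{N}^P$ and a transition $a\in T$ enabled in $M$, decide whether the step $Ma$ is e/l-$\mathrm{k}$-persistent.
   Context: A place/transition net (p/t-net) is $\mathrm{S}=(P,T,F,M_0)$ where $P$ (places) and $T$ (transitions) are finite disjoint sets, $F\subseteq P\times T\cup T\times P$ is the flow relation, and $M_0\in\mathbb{N}^P$ is the initial marking. Markings are vectors in $\mathbb{N}^P$, ordered and added componentwise. For $a\in T$, ${}^\bullet a\in\mathbb{N}^P$ is the vector with $1$ at places $p$ with $(p,a)\in F$ and $0$ elsewhere; $a^\bullet$ is the vector with $1$ at places $p$ with $(a,p)\in F$ and $0$ elsewhere. A transition $a$ is enabled in $M$ (written $Ma$) iff ${}^\bullet a\le M$; then firing $a$ yields $M'=(M-{}^\bullet a)+a^\bullet$ (written $MaM'$). This is extended to strings $w\in T^*$: $M\varepsilon M$, and $MvaM''$ iff $MvM'$ and $M'aM''$ for some $M'$; $Mw$ means $MwM'$ for some $M'$. For $\mathrm{k}\in\mathbb{N}$, a step $Ma$ (with $a$ enabled in $M$) is e/l-$\mathrm{k}$-persistent iff for every $b\in T$, $b\neq a$, $Mb$ implies that there exists $w\in T^*$ with $|w|\le\mathrm{k}$ and $Mawb$. *)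

(* Defs.v *)
From mathcomp Require Import all_boot.
Set Implicit Arguments.
Unset Strict Implicit.
Unset Printing Implicit Defensive.

(* Places and transitions live in separate types, hence are disjoint; the flow
   relation, a subset of P x T U T x P, is a set over the disjoint union of the
   two products: [inl (p, a)] is the arc (p, a), [inr (a, p)] the arc (a, p). *)
Record ptnet := PTNet {
  place : finType;
  trans : finType;
  flow : {set (place * trans) + (trans * place)};
  init : {ffun place -> nat}
}.

Notation marking S := {ffun place S -> nat}.

Section Firing.
Variable S : ptnet.
Implicit Types (M : marking S) (a b : trans S) (w : seq (trans S)).

Definition pre a : marking S := [ffun p => nat_of_bool (inl (p, a) \in flow S)].
Definition post a : marking S := [ffun p => nat_of_bool (inr (a, p) \in flow S)].

Definition marking_le M1 M2 := [forall p, M1 p <= M2 p].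

Definition enabled M a := marking_le (pre a) M.

(* The truncated subtraction is exact when [a] is enabled in [M]. *)
Definition fire M a : marking S := [ffun p => M p - pre a p + post a p].

Definition step M a M' := enabled M a /\ M' = fire M a.

Inductive run M : seq (trans S) -> marking S -> Prop :=
| run_nil : run M [::] M
| run_rcons v a M' M'' : run M v M' -> step M' a M'' -> run M (rcons v a) M''.

Definition fireable M w := exists M', run M w M'.

(* Meant for [a] enabled in [M]. *)
Definition el_persistent (k : nat) M a :=
  forall b, b != a -> enabled M b ->
    exists w, size w <= k /\ fireable M (a :: rcons w b).

End Firing.

Fixpoint prim_rec n (f : n.-tuple nat -> nat) (g : n.+2.-tuple nat -> nat)
    (x : nat) (u : n.-tuple nat) : nat :=
  if x is x'.+1 then g [tuple of x' :: prim_rec f g x' u :: u] else f u.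

(* The (total) general recursive functions.  Minimization is applied to
   regular functions only: the hypothesis of [rec_mu] makes [g v] the least
   zero of [f (_, v)], for every [v]. *)
Inductive recursive : forall n, (n.-tuple nat -> nat) -> Prop :=
| rec_zero n : @recursive n (fun=> 0)
| rec_succ : @recursive 1 (fun v => (thead v).+1)
| rec_proj n (i : 'I_n) : @recursive n (fun v => tnth v i)
| rec_comp k n (f : k.-tuple nat -> nat) (g : 'I_k -> n.-tuple nat -> nat) :
    recursive f -> (forall i, recursive (g i)) ->
    @recursive n (fun v => f [tuple g i v | i < k])
| rec_prim n (f : n.-tuple nat -> nat) (g : n.+2.-tuple nat -> nat) :
    recursive f -> recursive g ->
    @recursive n.+1 (fun v => prim_rec f g (thead v) [tuple of behead v])
| rec_mu n (f : n.+1.-tuple nat -> nat) (g : n.-tuple nat -> nat) :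
    (forall v, f [tuple of g v :: v] = 0 /\
               forall y, y < g v -> f [tuple of y :: v] <> 0) ->
    recursive f -> recursive g
| rec_ext n (f g : n.-tuple nat -> nat) : f =1 g -> recursive f -> recursive g.

(* [encode] presents instances as finite sequences of numbers; the library
   bijection [CodeSeq.code : seq nat -> nat] turns these into inputs. *)
Definition decidable_problem (I : Type) (encode : I -> seq nat)
    (Q : I -> Prop) : Prop :=
  exists d : 1.-tuple nat -> nat, recursive d /\
    forall x : I,
      (Q x -> d [tuple CodeSeq.code (encode x)] = 1) /\
      (~ Q x -> d [tuple CodeSeq.code (encode x)] = 0).

Record step_instance := StepInstance {
  net : ptnet;
  mark : marking net;
  tran : trans net;
  tran_enabled : enabled mark tran
}.

(* Places and transitions are numbered by their position in the enumeration of
   their types; the flow relation is listed as two 0/1 incidence matrices. *)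
Definition encode_step (x : step_instance) : seq nat :=
  let S := net x in
  [:: #|place S|; #|trans S|; nat_of_ord (enum_rank (tran x))]
  ++ [seq nat_of_bool (inl (p, a) \in flow S) | p <- enum (place S), a <- enum (trans S)]
  ++ [seq nat_of_bool (inr (a, p) \in flow S) | p <- enum (place S), a <- enum (trans S)]
  ++ [seq init S p | p <- enum (place S)]
  ++ [seq mark x p | p <- enum (place S)].

Definition EL_step_persistence (k : nat) (x : step_instance) : Prop :=
  el_persistent k (mark x) (tran x).

(* Main.v *)
(** Since [k] bounds the length of [w], only finitely many words [a w b] have to
be tried.  A word is fireable in [M] iff, for each of its letters, the tokens
consumed up to and including that letter are at most [M] plus the tokens
produced before it; this avoids computing intermediate markings.  A word
of length [m] over letters below [T] has a code below [2 ^ (m * T)], so the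
whole question is a bounded-quantifier formula over numbers, and these
define recursive functions. *)

From mathcomp Require Import all_boot zify.
Require Import Defs.
Set Implicit Arguments.
Unset Strict Implicit.
Unset Printing Implicit Defensive.

(** * Closure of recursive functions under substitution and iteration *)

Definition rec_env m n (s : m.-tuple nat -> n.-tuple nat) :=
  forall i, recursive (fun u => tnth (s u) i).

Lemma rec_env_id n : rec_env (fun v : n.-tuple nat => v).
Proof. by move=> i; apply: rec_proj. Qed.

Lemma rec_env_behead m n (s : m.-tuple nat -> n.+1.-tuple nat) :
  rec_env s -> rec_env (fun u => [tuple of behead (s u)]).
Proof.
by move=> rs i; apply: rec_ext (rs (inord i.+1)) => u; rewrite tnth_behead.
Qed.

Lemma rec_thead m n (s : m.-tuple nat -> n.+1.-tuple nat) :
  rec_env s -> recursive (fun u => thead (s u)).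
Proof. by move=> rs; apply: rs. Qed.

(** Serves mainly as weakening: a function of the outer variables stays recursive when read under
    additional binders. *)
Lemma rec_in_env m n (f : n.-tuple nat -> nat) (s : m.-tuple nat -> n.-tuple nat) :
  recursive f -> rec_env s -> recursive (fun u => f (s u)).
Proof.
move=> rf rs; apply: rec_ext (rec_comp rf rs) => u.
by congr f; apply: eq_from_tnth => i; rewrite tnth_mktuple.
Qed.

Section Closure.
Variable n : nat.
Implicit Types (f g h : n.-tuple nat -> nat) (b : n.-tuple nat -> bool).

Lemma rec_subst (F : n.+1.-tuple nat -> nat) g : recursive F -> recursive g ->
  recursive (fun v => F [tuple of g v :: v]).
Proof.
move=> rF rg.
(* Index 0 carries the new argument; [unlift] turns every other index into a projection. *)
pose G (i : 'I_n.+1) v := if unlift ord0 i is Some j then tnth v j else g v.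
have rG i : recursive (G i).
  rewrite /G; case: unlift => [j|]; [exact: rec_proj | exact: rg].
apply: rec_ext (rec_comp rF rG) => v; congr F; apply: eq_from_tnth => i.
rewrite tnth_mktuple /G; case: unliftP => [j|] ->; last by rewrite tnth0.
by rewrite tnthS.
Qed.

(** Primitive recursion in the form used for all the arithmetic below. The step reads its tuple as
    counter, accumulator, then parameters. *)
Lemma rec_iteri f g (G : n.-tuple nat -> nat -> nat -> nat) :
  recursive f -> recursive g ->
  @recursive n.+2 (fun u => G [tuple of behead [tuple of behead u]]
                              (thead u) (thead [tuple of behead u])) ->
  recursive (fun v => iteri (f v) (G v) (g v)).
Proof.
move=> rf rg rG; apply: rec_ext (rec_subst (rec_prim rg rG) rf) => v.
rewrite theadE; set w := [tuple of behead _].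
have -> : w = v by apply: val_inj.
elim: (f v) => //= m ->; rewrite theadE.
by congr (G _ _ _); apply: val_inj.
Qed.

Lemma rec_succn f : recursive f -> recursive (fun v => (f v).+1).
Proof.
move=> rf; apply: rec_ext (rec_comp rec_succ (fun=> rf)) => v.
by rewrite /thead tnth_mktuple.
Qed.

Lemma rec_const m : recursive (fun _ : n.-tuple nat => m).
Proof. elim: m => [|m]; [exact: rec_zero | exact: rec_succn]. Qed.

End Closure.

(** Variables behave as de Bruijn indices: each [behead] skips one binder and [thead] picks a
    variable. The first two cases weaken a hypothesis on a function or a predicate. *)
Ltac rec_var :=
  match goal with
  | rf : recursive ?f |- recursive (fun u => ?f _) => apply: (rec_in_env rf)
  | rf : recursive (fun v => nat_of_bool (?f v)) |- recursive (fun u => nat_of_bool (?f _)) => apply: (rec_in_env rf)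
  | |- _ => apply: rec_thead
  end; repeat apply: rec_env_behead; exact: rec_env_id.

(** * Elementary arithmetic and bounded sums *)

Lemma rec_addn n (f g : n.-tuple nat -> nat) : recursive f -> recursive g ->
  recursive (fun v => f v + g v).
Proof.
move=> rf rg.
apply: (@rec_ext _ (fun v => iteri (f v) (fun=> succn) (g v))) => [v|].
  by elim: (f v) => //= m ->.
by apply: rec_iteri => //; cbv beta; apply: rec_succn; rec_var.
Qed.

Lemma rec_muln n (f g : n.-tuple nat -> nat) : recursive f -> recursive g ->
  recursive (fun v => f v * g v).
Proof.
move=> rf rg.
apply: (@rec_ext _ (fun v => iteri (f v) (fun=> addn (g v)) 0)) => [v|].
  by elim: (f v) => //= m ->; rewrite mulSn.
by apply: rec_iteri (rec_const _ _) _ => //; cbv beta; apply: rec_addn; rec_var.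
Qed.

Lemma rec_expn n (f g : n.-tuple nat -> nat) : recursive f -> recursive g ->
  recursive (fun v => f v ^ g v).
Proof.
move=> rf rg.
apply: (@rec_ext _ (fun v => iteri (g v) (fun=> muln (f v)) 1)) => [v|].
  by elim: (g v) => //= m ->; rewrite expnS.
by apply: rec_iteri (rec_const _ _) _ => //; cbv beta; apply: rec_muln; rec_var.
Qed.

Lemma rec_predn n (f : n.-tuple nat -> nat) : recursive f -> recursive (fun v => (f v).-1).
Proof.
(* Returning the counter leaves its last value, the predecessor; the start value 0 covers
   [f v = 0]. *)
move=> rf; apply: (@rec_ext _ (fun v => iteri (f v) (fun i _ => i) 0)) => [v|].
  by case: (f v).
by apply: rec_iteri (rec_const _ _) _ => //; rec_var.
Qed.

Lemma rec_subn n (f g : n.-tuple nat -> nat) : recursive f -> recursive g ->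
  recursive (fun v => f v - g v).
Proof.
move=> rf rg.
apply: (@rec_ext _ (fun v => iteri (g v) (fun=> predn) (f v))) => [v|].
  by elim: (g v) => [|m IH]; rewrite ?subn0 //= IH subnS.
by apply: rec_iteri => //; cbv beta; apply: rec_predn; rec_var.
Qed.

Lemma rec_sum n (f : n.-tuple nat -> nat) (F : n.-tuple nat -> nat -> nat) : recursive f ->
  @recursive n.+1 (fun u => F [tuple of behead u] (thead u)) ->
  recursive (fun v => \sum_(0 <= i < f v) F v i).
Proof.
move=> rf rF.
apply: (@rec_ext _ (fun v => iteri (f v) (fun i => addn (F v i)) 0)) => [v|].
  by elim: (f v) => [|m IH]; rewrite ?big_nil // big_nat_recr //= -IH addnC.
apply: rec_iteri (rec_const _ _) _ => //; apply: rec_addn; last by rec_var.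
(* The summand ignores the accumulator, so this environment drops the second component. *)
have rs : rec_env (fun u : n.+2.-tuple nat =>
    [tuple of thead u :: behead [tuple of behead u]]).
  move=> i; case: (unliftP ord0 i) => [j|] ->; first last.
    by apply: rec_ext (rec_proj ord0) => u; rewrite tnth0.
  apply: rec_ext (rec_env_behead (rec_env_behead (@rec_env_id n.+2)) j) => u.
  by rewrite tnthS.
apply: rec_ext (rec_in_env rF rs) => u.
by rewrite theadE; congr (F _ _); apply: val_inj.
Qed.

(** * Connectives and bounded quantifiers, with truth values 0 and 1 *)

Lemma rec_not n (b : n.-tuple nat -> bool) : recursive b -> recursive (fun v => ~~ b v).
Proof.
move=> rb; apply: rec_ext (rec_subn (rec_const _ 1) rb) => v.
by case: (b v).
Qed.

Lemma rec_and n (b1 b2 : n.-tuple nat -> bool) : recursive b1 -> recursive b2 ->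
  recursive (fun v => b1 v && b2 v).
Proof.
move=> r1 r2; apply: rec_ext (rec_muln r1 r2) => v.
by rewrite mulnb.
Qed.

Lemma rec_imply n (b1 b2 : n.-tuple nat -> bool) : recursive b1 -> recursive b2 ->
  recursive (fun v => b1 v ==> b2 v).
Proof.
move=> r1 r2; apply: rec_ext (rec_not (rec_and r1 (rec_not r2))) => v.
by case: (b1 v) (b2 v) => [] [].
Qed.

Lemma rec_leq n (f g : n.-tuple nat -> nat) : recursive f -> recursive g ->
  recursive (fun v => f v <= g v).
Proof.
move=> rf rg; apply: rec_ext (rec_subn (rec_const _ 1) (rec_subn rf rg)) => v.
by rewrite /leq; case: (f v - g v).
Qed.

Lemma rec_eqn n (f g : n.-tuple nat -> nat) : recursive f -> recursive g ->
  recursive (fun v => f v == g v).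
Proof.
move=> rf rg; apply: rec_ext (rec_and (rec_leq rf rg) (rec_leq rg rf)) => v.
by rewrite eqn_leq.
Qed.

Lemma rec_all n (f : n.-tuple nat -> nat) (B : n.-tuple nat -> nat -> bool) : recursive f ->
  @recursive n.+1 (fun u => B [tuple of behead u] (thead u)) ->
  recursive (fun v => all (B v) (iota 0 (f v))).
Proof.
move=> rf rB.
(* A bounded universal statement holds when the number of its counterexamples is 0. *)
apply: rec_ext (rec_eqn (rec_sum (F := fun v i => ~~ B v i) rf (rec_not rB)) (rec_const _ 0)) => v.
congr nat_of_bool; rewrite sum_nat_seq_eq0 /index_iota subn0.
by apply: eq_all => i /=; rewrite eqb0 negbK.
Qed.

Lemma rec_has n (f : n.-tuple nat -> nat) (B : n.-tuple nat -> nat -> bool) : recursive f ->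
  @recursive n.+1 (fun u => B [tuple of behead u] (thead u)) ->
  recursive (fun v => has (B v) (iota 0 (f v))).
Proof.
move=> rf rB.
apply: rec_ext (rec_not (rec_all (B := fun v i => ~~ B v i) rf (rec_not rB))) => v.
by rewrite -has_predC; congr nat_of_bool; apply: eq_has => i /=; rewrite negbK.
Qed.

(** * Division and the exponent of 2 *)

Lemma sum_ltn_nat m q : \sum_(0 <= i < m) (i < q) = minn m q.
Proof.
elim: m => [|m IH]; first by rewrite big_nil min0n.
by rewrite big_nat_recr //= IH; lia.
Qed.

(** The quotient counts the positive multiples of [g v] up to [f v]. The conjunct [0 < g v] gives 0
    for division by 0, as [%/] does. *)
Lemma rec_divn n (f g : n.-tuple nat -> nat) : recursive f -> recursive g ->
  recursive (fun v => f v %/ g v).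
Proof.
move=> rf rg.
apply: (@rec_ext _ (fun v => \sum_(0 <= i < f v) ((0 < g v) && (i.+1 * g v <= f v)))) => [v|].
  have [-> | g_gt0] := posnP (g v); first by rewrite divn0 big1.
  rewrite -[RHS](minn_idPr (leq_div (f v) (g v))) -sum_ltn_nat.
  by apply: eq_bigr => i _; rewrite -leq_divRL.
apply: rec_sum => //; apply: rec_and; first by apply: rec_leq; [exact: rec_const | rec_var].
by apply: rec_leq; [apply: rec_muln; [apply: rec_succn|]|]; rec_var.
Qed.

Lemma rec_dvdn n (f g : n.-tuple nat -> nat) : recursive f -> recursive g ->
  recursive (fun v => f v %| g v).
Proof.
move=> rf rg; apply: rec_ext (rec_eqn (rec_muln (rec_divn rg rf) rf) rg) => v.
by rewrite dvdn_eq.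
Qed.

Lemma rec_logn2 n (f : n.-tuple nat -> nat) : recursive f -> recursive (fun v => logn 2 (f v)).
Proof.
(* For positive [f v], the count of powers of 2 dividing it includes the exponent 0, hence the
   predecessor; exponents from [f v] on give powers too large to divide it. *)
move=> rf; apply: (@rec_ext _ (fun v => (\sum_(0 <= i < f v) (2 ^ i %| f v)).-1)) => [v|].
  rewrite logn_count_dvd //; case: (f v) => [|m]; first by rewrite !big_geq.
  by rewrite big_ltn // dvd1n.
apply/rec_predn/rec_sum => //; apply: rec_dvdn; last by rec_var.
by apply: rec_expn; [exact: rec_const | rec_var].
Qed.

(** * Arithmetical decoding of sequences *)

Definition code_tail c := c %/ 2 ^ (logn 2 c).+1.

(** The code of [x :: s] is [2 ^ x * (2 * code s + 1)]: the exponent of 2 is the head, and the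
    quotient by [2 ^ x.+1] is the code of the tail. *)
Definition entry c i := logn 2 (iter i code_tail c).

Lemma logn2_code x s : logn 2 (CodeSeq.code (x :: s)) = x.
Proof.
rewrite /= lognM ?expn_gt0 // pfactorK //.
by rewrite -{2}[x]addn0; congr addn; apply: logn_coprime; rewrite coprime2n /= odd_double.
Qed.

Lemma code_tailE x s : code_tail (CodeSeq.code (x :: s)) = CodeSeq.code s.
Proof.
rewrite /code_tail logn2_code /= expnSr divnMA mulKn ?expn_gt0 //.
by rewrite divn2 /= uphalf_double.
Qed.

Lemma entry_code s i : entry (CodeSeq.code s) i = nth 0 s i.
Proof.
elim: i s => [|i IH] [|x s] //; rewrite /entry.
- exact: logn2_code.
(* Past the end the code is 0, a fixed point of [code_tail] with [logn] 0, which agrees with the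
   default of [nth]. *)
- by rewrite /= iter_fix.
- by rewrite iterSr code_tailE -/(entry _ _) IH.
Qed.

Lemma rec_entry n (f g : n.-tuple nat -> nat) : recursive f -> recursive g ->
  recursive (fun v => entry (f v) (g v)).
Proof.
move=> rf rg.
apply: (@rec_ext _ (fun v => logn 2 (iteri (g v) (fun=> code_tail) (f v)))) => [v|].
  by congr logn; elim: (g v) => //= m ->.
apply: rec_logn2; apply: rec_iteri => //; rewrite /code_tail.
apply: rec_divn; first by rec_var.
by apply: rec_expn; [exact: rec_const | apply/rec_succn/rec_logn2; rec_var].
Qed.

(** Makes the search for a word finite. A letter [x < m] in front of a code [d] gives
    [2 ^ x * (2 * d + 1) < 2 ^ m * (d + 1)], so each letter costs at most a factor [2 ^ m]. *)
Lemma ltn_code_expn m s : all (fun x => x < m) s -> CodeSeq.code s < 2 ^ (size s * m).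
Proof.
elim: s => [|x s IH] //= /andP[lt_xm /IH lt_s]; rewrite mulSn expnD.
have le_x : 2 ^ x * 2 <= 2 ^ m by rewrite -expnSr leq_exp2l.
apply: leq_trans (leq_mul le_x lt_s); rewrite -mulnA ltn_pmul2l ?expn_gt0 //.
by rewrite mul2n doubleS.
Qed.

(** * Tables and quantifiers indexed by enumeration ranks *)

Lemma nth_allpairs (P A : Type) (p0 : P) (a0 : A) (f : P -> A -> nat) s t i j :
  i < size s -> j < size t ->
  nth 0 [seq f p a | p <- s, a <- t] (i * size t + j) = f (nth p0 s i) (nth a0 t j).
Proof.
move=> + lt_j; elim: s i => // p s IH [|i] lt_i.
  by rewrite allpairs_cons nth_cat size_map lt_j (nth_map a0).
by rewrite allpairs_cons nth_cat size_map mulSn -addnA ltnNge leq_addr /= addKn IH.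
Qed.

Lemma nth_allpairs_enum (P A : finType) (f : P -> A -> nat) p a :
  nth 0 [seq f p a | p <- enum P, a <- enum A] (enum_rank p * #|A| + enum_rank a) = f p a.
Proof.
have := @nth_allpairs _ _ p a f (enum P) (enum A) (enum_rank p) (enum_rank a).
by rewrite -!cardE !nth_enum_rank; apply; exact: ltn_ord.
Qed.

Lemma nth_map_enum (P : finType) (f : P -> nat) p : nth 0 [seq f p | p <- enum P] (enum_rank p) = f p.
Proof. by rewrite (nth_map p) ?nth_enum_rank // -cardE ltn_ord. Qed.

Lemma all_iota_rank (T : finType) (B : nat -> bool) :
  all B (iota 0 #|T|) = [forall t : T, B (enum_rank t)].
Proof.
apply/allP/forallP => [B_all t | B_all i].
  by apply: B_all; rewrite mem_iota /= ltn_ord.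
rewrite mem_iota /= add0n => lt_i.
by have := B_all (enum_val (Ordinal lt_i)); rewrite enum_valK.
Qed.

(** * Fireability of words by counting tokens *)

Section Firing.
Variable S : ptnet.
Implicit Types (M : marking S) (s : seq (trans S)).

Definition firing_bound M s i :=
  forall p, \sum_(b <- take i.+1 s) pre b p <= M p + \sum_(b <- take i s) post b p.

Lemma run_rcons_inv M s a M'' : run M (rcons s a) M'' ->
  exists2 M', run M s M' & step M' a M''.
Proof.
move E: (rcons s a) => w r; case: w M'' / r E => [/(congr1 size)|v b M' M'' rv st /rcons_inj[-> ->]].
  by rewrite size_rcons.
by exists M'.
Qed.

(** Appending a letter leaves the shorter prefixes unchanged, so the only new condition is the one
    at position [size s]. *)
Lemma firing_bound_rcons M s a :
  (forall i, i < size (rcons s a) -> firing_bound M (rcons s a) i) <->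
  (forall i, i < size s -> firing_bound M s i) /\
  (forall p, \sum_(b <- s) pre b p + pre a p <= M p + \sum_(b <- s) post b p).
Proof.
rewrite size_rcons; have tk i : i <= size s -> take i (rcons s a) = take i s.
  by move=> le_i; rewrite -cats1 takel_cat.
have tkS : take (size s).+1 (rcons s a) = rcons s a by rewrite -(size_rcons s a) take_size.
split=> [fb | [fb fb_last] i].
  split=> [i lt_i p | p]; first by have := fb i (leqW lt_i) p; rewrite !tk // ltnW.
  by have := fb _ (leqnn _) p; rewrite tkS tk // take_size -cats1 big_cat big_seq1.
rewrite ltnS leq_eqVlt => /orP[/eqP-> p | lt_i p].
  by rewrite tkS tk // take_size -cats1 big_cat big_seq1.
by rewrite !tk // ?fb // ltnW.
Qed.

(** The second conjunct is the marking equation, kept additive to avoid truncated subtraction. In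
    the induction it turns enabledness of the last letter into its token bound. *)
Lemma run_bound M s M' : run M s M' ->
  (forall i, i < size s -> firing_bound M s i) /\
  (forall p, M' p + \sum_(b <- s) pre b p = M p + \sum_(b <- s) post b p).
Proof.
elim/last_ind: s M' => [|s a IH] M'.
  move E: [::] => w r; case: w M' / r E => [_|v b ? ? _ _ /(congr1 size)]; last by rewrite size_rcons.
  by split=> // p; rewrite !big_nil.
case/run_rcons_inv=> M1 /IH[fb eqM] [/forallP en ->]; split.
  by apply/firing_bound_rcons; split=> // p; rewrite -eqM addnC leq_add2r.
move=> p; rewrite -cats1 !big_cat !big_seq1 ffunE /=.
by have := eqM p; have := en p; lia.
Qed.

Lemma fireableP M s :
  fireable M s <-> forall i, i < size s -> firing_bound M s i.
Proof.
split=> [[M'] /run_bound[] //|]; elim/last_ind: s => [_ | s a IH].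
  by exists M; left.
case/firing_bound_rcons=> /IH[M' r] en; exists (fire M' a); right with M' => //.
split=> //; apply/forallP => p; have [_ eqM] := run_bound r.
by have := en p; rewrite -eqM addnC leq_add2r.
Qed.

End Firing.

(** * The decision procedure on codes *)

(* The offsets 3 + ... follow the layout of [encode_step]. *)
Definition code_pre c p a := entry c (3 + (p * entry c 1 + a)).

Definition code_post c p a := entry c (3 + (entry c 0 * entry c 1 + (p * entry c 1 + a))).

Definition code_mark c p :=
  entry c (3 + (entry c 0 * entry c 1 + (entry c 0 * entry c 1 + (entry c 0 + p)))).

Definition word_bound c W j :=
  all (fun p => \sum_(0 <= l < j.+1) code_pre c p (entry W l) <=
    code_mark c p + \sum_(0 <= l < j) code_post c p (entry W l)) (iota 0 (entry c 0)).

(** [W] stands for the word [a w b] with [L] the length of [w], so the last letter has position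
    [L.+1]. Entries of [W] beyond it are not read. *)
Definition word_check c b L W :=
  [&& entry W 0 == entry c 2, entry W L.+1 == b,
      all (fun j => entry W j < entry c 1) (iota 0 L.+2)
    & all (word_bound c W) (iota 0 L.+2)].

(** The bound on [W] is that of [ltn_code_expn] for [L.+2] letters, each below the number of
    transitions. *)
Definition step_decider k c :=
  all (fun b => (b != entry c 2) ==>
      all (fun p => code_pre c p b <= code_mark c p) (iota 0 (entry c 0)) ==>
      has (fun L => has (word_check c b L) (iota 0 (2 ^ (L.+2 * entry c 1)))) (iota 0 k.+1))
    (iota 0 (entry c 1)).

(* [rec_leq] must precede [rec_eqn], which would unfold [m <= n] to [m - n == 0]. *)
Ltac rec_tac := repeat first
  [ exact: rec_const | rec_var | apply: rec_all | apply: rec_has | apply: rec_sum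
  | apply: rec_imply | apply: rec_and | apply: rec_not | apply: rec_leq | apply: rec_eqn
  | apply: rec_succn | apply: rec_addn | apply: rec_muln | apply: rec_expn
  | apply: rec_entry ].

Lemma rec_step_decider k : @recursive 1 (fun v => step_decider k (thead v)).
Proof.
rewrite /step_decider /word_check /word_bound /code_pre /code_post /code_mark.
rec_tac.
Qed.

(** * Correctness of the procedure on encoded instances *)

Section EncodedStep.
Variable x : step_instance.
Notation S := (net x).
Notation c := (CodeSeq.code (encode_step x)).
Implicit Types (p : place S) (a b : trans S) (s : seq (trans S)).

Lemma entry_places : entry c 0 = #|place S|. Proof. by rewrite entry_code. Qed.

Lemma entry_trans : entry c 1 = #|trans S|. Proof. by rewrite entry_code. Qed.

Lemma entry_tran : entry c 2 = enum_rank (tran x). Proof. by rewrite entry_code. Qed.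

Lemma rank_pair_ltn p a : enum_rank p * #|trans S| + enum_rank a < #|place S| * #|trans S|.
Proof.
apply: (@leq_trans ((enum_rank p).+1 * #|trans S|)); last by rewrite leq_mul // ltn_ord.
by rewrite mulSnr ltn_add2l ltn_ord.
Qed.

Lemma code_preE p a : code_pre c (enum_rank p) (enum_rank a) = pre a p.
Proof.
rewrite /code_pre entry_trans entry_code /encode_step nth_cat /=.
rewrite !subSS subn0 nth_cat size_allpairs -!cardE rank_pair_ltn nth_allpairs_enum ffunE //.
Qed.

Lemma code_postE p a : code_post c (enum_rank p) (enum_rank a) = post a p.
Proof.
rewrite /code_post entry_places entry_trans entry_code /encode_step nth_cat /=.
rewrite !subSS subn0 nth_cat size_allpairs -!cardE ltnNge leq_addr /= addKn.
by rewrite nth_cat size_allpairs -!cardE rank_pair_ltn nth_allpairs_enum ffunE.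
Qed.

Lemma code_markE p : code_mark c (enum_rank p) = mark x p.
Proof.
rewrite /code_mark entry_places entry_trans entry_code /encode_step nth_cat /=.
rewrite !subSS subn0 3!nth_cat !size_allpairs -!cardE size_map -cardE.
rewrite !(ltnNge, leq_addr, addKn) /=; exact: nth_map_enum.
Qed.

(** [W] is only required to agree with [s] on the first [size s] entries, so the equivalence applies
    both to codes of words and to arbitrary numbers found by the search. *)
Lemma word_boundP W s j : (forall i, i < size s -> entry W i = enum_rank (nth (tran x) s i)) ->
  j < size s -> word_bound c W j <-> firing_bound (mark x) s j.
Proof.
move=> Ws lt_j.
(* One statement translates both the consumed and the produced tokens. *)
have sumE (F : nat -> nat -> nat) (G : trans S -> marking S) :
    (forall p a, F (enum_rank p) (enum_rank a) = G a p) ->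
    forall p i, i <= size s ->
    \sum_(0 <= l < i) F (enum_rank p) (entry W l) = \sum_(b <- take i s) G b p.
  move=> FG p i le_i; rewrite (big_nth (tran x)) size_takel // !big_nat.
  by apply: eq_bigr => l /= lt_l; rewrite nth_take // Ws ?FG // (leq_trans lt_l).
rewrite /word_bound entry_places all_iota_rank; split=> [/forallP h p | h].
  have := h p; rewrite (sumE _ _ code_preE) // (sumE _ _ code_postE) ?code_markE //.
  exact: ltnW.
apply/forallP => p; rewrite (sumE _ _ code_preE) // (sumE _ _ code_postE) ?code_markE //.
exact: ltnW.
Qed.

Lemma code_enabled b :
  all (fun i => code_pre c i (enum_rank b) <= code_mark c i) (iota 0 (entry c 0)) =
  enabled (mark x) b.
Proof.
rewrite entry_places all_iota_rank; apply: eq_forallb => p.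
by rewrite code_preE code_markE.
Qed.

Lemma word_check_code b w : fireable (mark x) (tran x :: rcons w b) ->
  word_check c (enum_rank b) (size w)
    (CodeSeq.code [seq nat_of_ord (enum_rank a) | a <- tran x :: rcons w b]).
Proof.
set s := tran x :: _ => /fireableP fb.
have Ws i : i < size s ->
    entry (CodeSeq.code [seq nat_of_ord (enum_rank a) | a <- s]) i = enum_rank (nth (tran x) s i).
  by move=> lt_i; rewrite entry_code (nth_map (tran x)).
have sz : size s = (size w).+2 by rewrite /= size_rcons.
have sL : nth (tran x) s (size w).+1 = b by rewrite /s [LHS]nth_rcons ltnn eqxx.
rewrite /word_check !Ws ?sz // entry_tran sL; apply/and4P; split=> //.
all: apply/allP => j; rewrite mem_iota add0n -sz => lt_j.
  by rewrite Ws // entry_trans ltn_ord.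
exact/(word_boundP Ws lt_j)/fb.
Qed.

Lemma word_check_fireable b L W : word_check c (enum_rank b) L W ->
  exists2 w, size w = L & fireable (mark x) (tran x :: rcons w b).
Proof.
case/and4P=> /eqP W0 /eqP WL /allP W_lt /allP W_bd.
(* Decodes the first [L.+2] entries; the default [tran x] is never reached, as all of them are below
   the number of transitions. *)
pose s := [seq nth (tran x) (enum (trans S)) (entry W j) | j <- iota 0 L.+2].
have sz : size s = L.+2 by rewrite size_map size_iota.
have Ws i : i < size s -> entry W i = enum_rank (nth (tran x) s i).
  rewrite sz => lt_i; rewrite (nth_map 0) ?size_iota // nth_iota // add0n.
  have : entry W i < #|trans S| by rewrite -entry_trans W_lt // mem_iota.
  by move=> lt_W; rewrite -[entry W i]/(val (Ordinal lt_W)) -enum_val_nth enum_valK.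
have fb : fireable (mark x) s.
  apply/fireableP => i lt_i; apply/(word_boundP Ws lt_i)/W_bd.
  by rewrite mem_iota -sz.
have s0 : nth (tran x) s 0 = tran x.
  by apply/enum_rank_inj/ord_inj; rewrite -Ws ?sz // W0 entry_tran.
have sL : nth (tran x) s L.+1 = b.
  by apply/enum_rank_inj/ord_inj; rewrite -Ws ?sz.
(* Having length at least 2, [s] splits into its first letter, a middle word [w] and its last
   letter. *)
case: {Ws W_lt W_bd}s sz s0 sL fb => // a t [] + /= ->; case/lastP: t => // w d.
rewrite size_rcons => -[<-]; rewrite nth_rcons ltnn eqxx => ->.
by exists w.
Qed.

Lemma step_deciderP k : reflect (EL_step_persistence k x) (step_decider k c).
Proof.
rewrite /step_decider entry_trans all_iota_rank; apply: (iffP forallP) => [dec b neq_b en|pers b].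
  have := dec b; rewrite entry_tran code_enabled en implyTb.
  rewrite (inj_eq val_inj) (inj_eq enum_rank_inj) neq_b implyTb.
  case/hasP=> L; rewrite mem_iota /= => le_L /hasP[W _ /word_check_fireable[w sz_w fw]].
  by exists w; rewrite sz_w.
apply/implyP; rewrite entry_tran (inj_eq val_inj) (inj_eq enum_rank_inj) => neq_b.
apply/implyP; rewrite code_enabled => en.
have [w [sz_w /word_check_code chk]] := pers b neq_b en.
apply/hasP; exists (size w); first by rewrite mem_iota.
apply/hasP; exists (CodeSeq.code [seq nat_of_ord (enum_rank a) | a <- tran x :: rcons w b]) => //.
rewrite mem_iota add0n.
(* Expressing [(size w).+2] as the length of the rank word gives the search bound the shape of
   [ltn_code_expn]. *)
have <- : size [seq nat_of_ord (enum_rank a) | a <- tran x :: rcons w b] = (size w).+2.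
  by rewrite size_map /= size_rcons.
apply: ltn_code_expn; apply/allP => _ /mapP[a _ ->]; exact: ltn_ord.
Qed.

End EncodedStep.

Theorem theorem3 (k : nat) :
  decidable_problem encode_step (EL_step_persistence k).
Proof.
exists (fun v => step_decider k (thead v)); split=> [|x]; first exact: rec_step_decider.
by rewrite theadE; split=> [/step_deciderP-> | /step_deciderP/negbTE->].
Qed.
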